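(* Let $\mathcal{C}$ be the circumference of a circle of radius $r>0$. Then $\mathcal{C}=2\pi r$.
   Context: Here $\pi$ is defined through area: it denotes the constant $\mathcal{A}/r^2$, where $\mathcal{A}$ is the area of (the disc bounded by) a circle of radius $r$, this ratio being independent of $r$. The circumference is the arc-length of the whole circle, i.e. its length in the usual sense (distance along the curve). *)

(* Defs.v *)
From HB Require Import structures.
From mathcomp Require Import all_boot all_order all_algebra.
From mathcomp Require Import all_classical all_reals all_analysis.
From mathcomp Require Import measurable_realfun ring lra.

Set Implicit Arguments.
Unset Strict Implicit.
Unset Printing Implicit Defensive.

Import Order.TTheory GRing.Theory Num.Theory.
Import numFieldNormedType.Exports.

Local Open Scope classical_set_scope.
Local Open Scope ring_scope.

(* The plane is [R * R]. Its library norm is the max norm, hence a separate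
   Euclidean distance. *)
Definition dist2 (R : realType) (p q : R * R) : R :=
  Num.sqrt ((p.1 - q.1) ^+ 2 + (p.2 - q.2) ^+ 2).

Definition circle (R : realType) (c : R * R) (r : R) : set (R * R) :=
  [set p | dist2 c p = r].

Definition disc (R : realType) (c : R * R) (r : R) : set (R * R) :=
  [set p | dist2 c p <= r].

Definition area (R : realType) (A : set (R * R)) : \bar R :=
  (@lebesgue_measure R \x @lebesgue_measure R)%E A.

(* [fine] loses nothing here: discs have finite area, see [area_disc]. *)
Definition area_ratio (R : realType) (c : R * R) (r : R) : R :=
  fine (area (disc c r)) / r ^+ 2.

(* The number pi defined by area, evaluated on the unit disc at the origin;
   [area_ratio_const] shows that any other circle gives the same value.
   It is not the library's [pi], which is defined from the zeros of [cos]. *)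
Definition area_pi (R : realType) : R := area_ratio (0 : R * R) 1.

(* Length of the polygonal line with vertices [g a, g s_0, ..., g s_(n-1)];
   compare [variation]. *)
Definition polygonal_length (R : realType) (a b : R) (g : R -> R * R)
    (s : seq R) : R :=
  let G := g \o nth b (a :: s) in
  \sum_(0 <= n < size s) dist2 (G n) (G n.+1).

Definition curve_length (R : realType) (a b : R) (g : R -> R * R) : \bar R :=
  ereal_sup [set (polygonal_length a b g s)%:E | s in itv_partition a b].

Definition simple_closed_parametrization (R : realType) (A : set (R * R))
    (a b : R) (g : R -> R * R) : Prop :=
  [/\ a < b, {within `[a, b], continuous g}, g a = g b,
      {in `[a, b[ &, injective g} & g @` `[a, b] = A].

(* Arc length of a simple closed curve given as a set of points: the length of
   a parametrization running through it exactly once. *)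
Definition is_arc_length (R : realType) (A : set (R * R)) (l : \bar R) : Prop :=
  exists (a b : R) (g : R -> R * R),
    simple_closed_parametrization A a b g /\ curve_length a b g = l.

Definition is_circumference (R : realType) (c : R * R) (r : R)
    (l : \bar R) : Prop :=
  is_arc_length (circle c r) l.

Section area_disc.
Context {R : realType}.
Local Notation mu := (@lebesgue_measure R).

Lemma dist2_ge0 (p q : R * R) : 0 <= dist2 p q.
Proof. exact: sqrtr_ge0. Qed.

Lemma discE (c : R * R) (r : R) : 0 <= r ->
  disc c r = [set p | (p.1 - c.1) ^+ 2 + (p.2 - c.2) ^+ 2 <= r ^+ 2].
Proof.
move=> r0; apply/seteqP; split => p; rewrite /disc /dist2 /= => h.
  rewrite -(ler_sqrt _ (sqr_ge0 r)) sqrtr_sqr (ger0_norm r0).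
  by rewrite -(sqrrN (p.1 - _)) -(sqrrN (p.2 - _)) !opprB.
rewrite -(ger0_norm r0) -sqrtr_sqr ler_sqrt ?sqr_ge0//.
by rewrite -(sqrrN (c.1 - _)) -(sqrrN (c.2 - _)) !opprB.
Qed.

Let line (c r x : R) : R := r * x + c.

Let mline (c r : R) :
  measurable_fun [set: measurableTypeR R]
    (line c r : measurableTypeR R -> measurableTypeR R).
Proof. by apply: measurable_funD => //; exact: measurable_funM. Qed.

Let mu_line (c r : R) (A : set (measurableTypeR R)) : 0 < r ->
  measurable A -> (r%:E * mu (line c r @^-1` A))%E = mu A.
Proof.
move=> r0 mA.
pose rr : {nonneg R} := NngNum (ltW r0).
have mm := mline c r.
pose m2 : {measure set (measurableTypeR R) -> \bar R} :=
  mscale rr (pushforward mu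
    (line c r : measurableTypeR R -> measurableTypeR R)).
have -> : (r%:E * mu (line c r @^-1` A))%E = m2 mm A by [].
apply/esym.
apply: (lebesgue_measure_unique (mu := m2 mm)) => // _ [[a b]] _ <-.
pose J : set R := `](a - c) / r, (b - c) / r]%classic.
have E : line c r @^-1` `]a, b] = J.
  apply/seteqP; split => x; rewrite /J /line /= !in_itv/=;
    rewrite ltr_pdivrMr// ler_pdivlMr// (mulrC x) => /andP[h1 h2];
    by apply/andP; split; lra.
rewrite [RHS](_ : _ = (r%:E * mu J)%E);
  last by rewrite -E.
rewrite /J !lebesgue_measure_itv/= !lte_fin ltr_pM2r ?invr_gt0// ltrD2r.
case: ifP => _; last by rewrite mule0.
rewrite -EFinM; congr EFin; field.
by rewrite gt_eqF.
Qed.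

Let area_affine (c : R * R) (r : R) (A : set (R * R)) : 0 < r ->
  measurable (A : set (measurableTypeR R * measurableTypeR R)) ->
  area A =
  ((r ^+ 2)%:E * area ((fun p => (line c.1 r p.1, line c.2 r p.2)) @^-1` A))%E.
Proof.
move=> r0 mA.
pose f (p : measurableTypeR R * measurableTypeR R) :
  measurableTypeR R * measurableTypeR R := (line c.1 r p.1, line c.2 r p.2).
have mf : measurable_fun setT f.
  by apply: measurable_fun_pair; apply: measurableT_comp => //; exact: mline.
pose rr : {nonneg R} := NngNum (sqr_ge0 r).
pose m2 : {measure set (measurableTypeR R * measurableTypeR R) -> \bar R} :=
  mscale rr (pushforward (mu \x mu)%E f).
rewrite /area (@product_measure_unique _ _ _ _ _ mu mu (m2 mf))//.
move=> X Y mX mY.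
change ((r ^+ 2)%:E * (mu \x mu) ((line c.1 r @^-1` X) `*`
  (line c.2 r @^-1` Y)) = mu X * mu Y)%E.
have pm c' (Z : set (measurableTypeR R)) : measurable Z ->
    measurable (line c' r @^-1` Z : set (measurableTypeR R)).
  by move=> mZ; rewrite -[X in measurable X]setTI; exact: mline.
rewrite product_measure1E; [|exact: pm|exact: pm].
rewrite -(mu_line c.1 r0 mX) -(mu_line c.2 r0 mY) expr2 EFinM.
by rewrite muleACA.
Qed.

Lemma measurable_disc (c : R * R) (r : R) :
  measurable (disc c r : set (measurableTypeR R * measurableTypeR R)).
Proof.
have [r0|r0] := leP 0 r; last first.
  rewrite (_ : disc _ _ = set0)//; apply/seteqP; split => // p /=.
  by rewrite /disc/= leNgt (lt_le_trans r0)// dist2_ge0.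
rewrite discE//.
pose h (p : measurableTypeR R * measurableTypeR R) : R :=
  (p.1 - c.1) ^+ 2 + (p.2 - c.2) ^+ 2.
have mh : measurable_fun setT h.
  by apply: measurable_funD; apply: measurable_funX; apply: measurable_funB.
rewrite (_ : [set p | _] = setT `&` h @^-1` `]-oo, (r ^+ 2)]%classic).
  exact: mh.
by rewrite setTI; apply/seteqP; split => p /=; rewrite in_itv.
Qed.

Lemma area_disc (c : R * R) (r : R) : 0 < r ->
  area (disc c r) = (area_pi R * r ^+ 2)%:E.
Proof.
move=> r0; rewrite (area_affine c r0 (measurable_disc c r)).
have -> : (fun p => (line c.1 r p.1, line c.2 r p.2)) @^-1` disc c r =
    disc (0 : R * R) 1.
  rewrite (discE _ (ltW r0)) discE// /line; apply/seteqP.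
  have r20 : 0 < r ^+ 2 by rewrite exprn_gt0.
  split => p /=; rewrite !addrK !exprMn -mulrDr !subr0 expr1n.
    by rewrite ger_pMr.
  by rewrite ger_pMr.
have fin : area (disc (0 : R * R) 1) \is a fin_num.
  rewrite ge0_fin_numE; last exact: measure_ge0.
  have mI : measurable (`[(-1)%R, 1%R]%classic : set (measurableTypeR R)).
    exact: measurable_itv.
  apply: (@le_lt_trans _ _ (area (`[-1, 1]%classic `*` `[-1, 1]%classic))).
    apply: le_measure; rewrite ?inE; [exact: measurable_disc|exact: measurableX|].
    rewrite discE// => p /=; rewrite !subr0 expr1n !in_itv/= => h.
    have lt1 (x y : R) : x ^+ 2 + y ^+ 2 <= 1 -> (-1 <= x) && (x <= 1).
      by move=> xy; rewrite -ler_norml -(ler_pXn2r (n := 2))//= ?nnegrE//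
        real_normK ?num_real// expr1n (le_trans _ xy)// lerDl sqr_ge0.
    by split; [exact: lt1 h|move: h; rewrite addrC; exact: lt1].
  have muI : mu `[(-1)%R, 1%R]%classic = 2%:E.
    by rewrite lebesgue_measure_itv/= lte_fin ifT; [congr EFin|]; lra.
  by rewrite /area product_measure1E// [X in (X * _)%E]muI
    [X in (_ * X)%E]muI ltry.
rewrite /area_pi /area_ratio expr1n divr1 [RHS]EFinM fineK//.
by rewrite muleC.
Qed.

Lemma area_ratio_const (c : R * R) (r : R) : 0 < r ->
  area_ratio c r = area_pi R.
Proof.
move=> r0; rewrite /area_ratio area_disc//= mulfK//.
by rewrite expf_eq0/= gt_eqF.
Qed.

End area_disc.

Lemma circle_parametrization (R : realType) (c : R * R) (r : R) : 0 < r ->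
  simple_closed_parametrization (circle c r) 0 (2 * pi)
    (fun t => (c.1 + r * cos t, c.2 + r * sin t)).
Proof.
move=> r0; have pi0 := pi_gt0 R.
have circE p : circle c r p <-> (p.1 - c.1) ^+ 2 + (p.2 - c.2) ^+ 2 = r ^+ 2.
  rewrite /circle/= /dist2 -(sqrrN (c.1 - _)) -(sqrrN (c.2 - _)) !opprB.
  split=> [<-|->]; first by rewrite sqr_sqrtr// addr_ge0// sqr_ge0.
  by rewrite sqrtr_sqr gtr0_norm.
split.
- by rewrite mulr_gt0.
- apply: continuous_subspaceT => t.
  apply: (@cvg_pair _ _ _ _ (nbhs (c.1 + r * cos t)) (nbhs (c.2 + r * sin t))).
    by apply: cvgD; [exact: cvg_cst|apply: cvgMl_tmp; exact: continuous_cos].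
  by apply: cvgD; [exact: cvg_cst|apply: cvgMl_tmp; exact: continuous_sin].
- by rewrite mulr_natl cos2pi sin2pi cos0 sin0.
- have cos1 (t : R) : 0 <= t -> t < 2 * pi -> cos t = 1 -> t = 0.
    move=> t0 t2 ct; apply/eqP; rewrite eq_le t0 andbT leNgt; apply/negP => tgt0.
    have : 0 < sin (t / 2) by apply: sin_gt0_pi; apply/andP; split; lra.
    have := cos_mulr2n (t / 2).
    rewrite (_ : t / 2 *+ 2 = t) ?ct; last by rewrite -mulr_natr divfK.
    have := cos2Dsin2 (t / 2) => + + s0.
    have : 0 < sin (t / 2) ^+ 2 by rewrite exprn_gt0.
    lra.
  have main (s t : R) : 0 <= s -> s <= t -> t < 2 * pi ->
      cos s = cos t -> sin s = sin t -> s = t.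
    move=> s0 st t2 cst sst.
    suff : t - s = 0 by lra.
    apply: cos1; [lra|lra|].
    by rewrite cosB cst sst -!expr2 cos2Dsin2.
  move=> s t; rewrite !in_itv/= => /andP[s0 s2] /andP[t0 t2] [].
  move=> /addrI/(mulfI (lt0r_neq0 r0)) cst /addrI/(mulfI (lt0r_neq0 r0)) sst.
  have [st|/ltW ts] := leP s t; first exact: main.
  by apply/esym; apply: main.
- apply/seteqP; split => [_ [t _ <-]|p /circE Hp].
    apply/circE => /=; rewrite !(addrC _.1) !(addrC _.2) !addrK !exprMn.
    by rewrite -mulrDr cos2Dsin2 mulr1.
  pose x := (p.1 - c.1) / r; pose y := (p.2 - c.2) / r.
  have rn0 : r != 0 by rewrite gt_eqF.
  have xy : x ^+ 2 + y ^+ 2 = 1.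
    by rewrite /x /y !expr_div_n -mulrDl Hp divff// expf_neq0.
  have x1 : -1 <= x <= 1.
    rewrite -ler_norml -(ler_pXn2r (n := 2))//= ?nnegrE//.
    by rewrite real_normK ?num_real// expr1n -xy lerDl sqr_ge0.
  have pE : p = (c.1 + r * x, c.2 + r * y).
    rewrite /x /y [LHS]surjective_pairing; congr pair.
      by field.
    by field.
  have ya : `|y| = Num.sqrt (1 - x ^+ 2).
    by rewrite -xy addrAC subrr add0r sqrtr_sqr.
  have a0 := acos_ge0 x1; have api := acos_lepi x1.
  have [y0|y0] := leP 0 y.
    exists (acos x); first by rewrite /= in_itv/=; apply/andP; split; lra.
    by rewrite [RHS]pE acosK// sin_acos// -ya ger0_norm.
  exists (2 * pi - acos x); first by rewrite /= in_itv/=; apply/andP; split; lra.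
  have -> : 2 * pi - acos x = - acos x + pi *+ 2 by rewrite mulr_natl addrC.
  rewrite cosD2pi sinD2pi cosN sinN [RHS]pE acosK// sin_acos// -ya.
  by rewrite ltr0_norm// opprK.
Qed.

Lemma ex_circumference (R : realType) (c : R * R) (r : R) : 0 < r ->
  exists l, is_circumference c r l.
Proof.
move=> r0; pose g t : R * R := (c.1 + r * cos t, c.2 + r * sin t).
exists (curve_length 0 (2 * pi) g), 0, (2 * pi), g.
by split; first exact: circle_parametrization.
Qed.

(* Main.v *)
(* Both sides equal 2 pi r for the analytic constant pi of the library.

   Area: the vertical section of the unit disc over x has length
   2 sqrt(1 - x^2), a function with primitive x sqrt(1 - x^2) + asin x.

   Length: measure angles from the point opposite to g(a), as
   2 atan(y / (1 + x)), which is continuous away from g(a). The angle of g(t) is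
   then continuous and injective on ]a, b[, hence strictly monotone, and runs
   over ]-pi, pi[. The chord between angles s and t is 2 r |sin((s - t) / 2)|, at
   most r |s - t|, so every inscribed polygon has length at most 2 pi r; the
   regular n-gon has length 2 n r sin(pi / n) >= 2 pi r (1 - pi^2 / (2 n^2)). *)

Require Import Defs.
From mathcomp Require Import all_boot all_order all_algebra.
From mathcomp Require Import all_classical all_reals all_analysis.
From mathcomp Require Import ring lra.

Import Order.TTheory GRing.Theory Num.Theory.
Import numFieldNormedType.Exports.

Local Open Scope classical_set_scope.
Local Open Scope ring_scope.

(** * Bounds on the sine and the chord formula *)

Lemma sinMcos_MVT {R : realType} (x : R) : 0 <= x ->
  exists2 y : R, 0 <= y <= x & sin x = x * cos y.
Proof.
move=> x0.
have cs : {within `[0, x], continuous (@sin R)}.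
  exact/continuous_subspaceT/continuous_sin.
have [y yx] := MVT_segment x0 (fun y _ => is_derive_sin y) cs.
rewrite sin0 !subr0 mulrC => ->; by exists y.
Qed.

Lemma normr_sin_le {R : realType} (x : R) : `|sin x| <= `|x|.
Proof.
wlog x0 : x / 0 <= x.
  move=> h; have [|/ltW x0] := leP 0 x; first exact: h.
  by rewrite -normrN -sinN -(normrN x) h// oppr_ge0.
have [y _ ->] := sinMcos_MVT x x0.
by rewrite normrM ler_piMr// ler_norml cos_geN1 cos_le1.
Qed.

Lemma cos_sin_half {R : realType} (x : R) : cos x = 1 - 2 * sin (x / 2) ^+ 2.
Proof.
have := cos_mulr2n (x / 2); rewrite -[_ *+ 2]mulr_natr divfK// => ->.
by have := cos2Dsin2 (x / 2); lra.
Qed.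

(** In [sin x = x * cos y] the half-angle formula and [normr_sin_le] give cos y >= 1 - y^2/2, and y
    <= x. The cubic loss makes the deficit of the regular n-gon of order 1/n^2. *)
Lemma sin_ge_cubic {R : realType} (x : R) : 0 <= x ->
  x * (1 - x ^+ 2 / 2) <= sin x.
Proof.
move=> x0; have [y /andP[y0 yx] ->] := sinMcos_MVT x x0.
apply: ler_wpM2l => //; rewrite cos_sin_half.
have : sin (y / 2) ^+ 2 <= (x / 2) ^+ 2.
  rewrite -(real_normK (num_real (sin _))) ler_sqr ?nnegrE//; last lra.
  by rewrite (le_trans (normr_sin_le _))// ger0_norm; lra.
by rewrite expr_div_n; lra.
Qed.

(* The point reached from [c + v] by turning through [t] around [c]. *)
Definition rotate {R : realType} (c v : R * R) (t : R) : R * R :=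
  (c.1 + (v.1 * cos t - v.2 * sin t), c.2 + (v.2 * cos t + v.1 * sin t)).

(** The squared chord is 2 r^2 (1 - cos (s - t)), which the half-angle formula turns into a
    square. *)
Lemma dist2_rotate {R : realType} (c v : R * R) (r s t : R) : 0 <= r ->
  v.1 ^+ 2 + v.2 ^+ 2 = r ^+ 2 ->
  dist2 (rotate c v s) (rotate c v t) = 2 * r * `|sin ((s - t) / 2)|.
Proof.
move=> r0 vr; rewrite /dist2 /=.
transitivity (Num.sqrt ((2 * r * sin ((s - t) / 2)) ^+ 2)); last first.
  by rewrite sqrtr_sqr normrM ger0_norm// mulr_ge0.
congr Num.sqrt.
have E : 4 * sin ((s - t) / 2) ^+ 2 =
    2 * (1 - (cos s * cos t + sin s * sin t)).
  by have := cos_sin_half (s - t); rewrite cosB; lra.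
rewrite !exprMn -vr (_ : 2 ^+ 2 = 4 :> R); last by lra.
rewrite mulrAC E.
have := cos2Dsin2 s; have := cos2Dsin2 t.
move: (cos s) (sin s) (cos t) (sin t) => cs ss ct st h1 h2.
transitivity ((v.1 ^+ 2 + v.2 ^+ 2) *
  ((cs ^+ 2 + ss ^+ 2) + (ct ^+ 2 + st ^+ 2) - 2 * (cs * ct + ss * st))).
  by ring.
by rewrite h1 h2; ring.
Qed.

(** * Length of a curve described by an increasing angle function *)

Section curve_length_angle.
Context {R : realType} {a b r : R} {g : R -> R * R} {H : R -> R}.
(** [H] stands for the angle along one full turn. Surjectivity takes the place of continuity, and
    the geometry of the circle is summed up in the chord formula [gH]. *)
Hypotheses (r0 : 0 < r) (ab : a <= b)
  (Hlt : {in `[a, b] &, {homo H : x y / x < y}})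
  (Ha : H a = - pi) (Hb : H b = pi)
  (Hsurj : forall t, - pi <= t <= pi -> exists2 s, s \in `[a, b] & H s = t)
  (gH : {in `[a, b] &, forall s t,
     dist2 (g s) (g t) = 2 * r * `|sin ((H s - H t) / 2)|}).

Let Hle : {in `[a, b] &, {homo H : x y / x <= y}}.
Proof.
move=> x y xI yI; rewrite le_eqVlt => /predU1P[->//|xy].
exact/ltW/Hlt.
Qed.

(** Each chord is at most [r] times the increment of [H], and these increments telescope to 2 pi. *)
Lemma polygonal_length_le s : itv_partition a b s ->
  polygonal_length a b g s <= 2 * pi * r.
Proof.
move=> abs; rewrite /polygonal_length.
set G := nth b (a :: s).
have GI k : (k < (size s).+1)%N -> G k \in `[a, b].
  by move=> ks; rewrite in_itv/= itv_partition_nth_ge// itv_partition_nth_le.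
apply: (@le_trans _ _ (\sum_(0 <= n < size s) (r * (H (G n.+1) - H (G n))))).
  rewrite !big_nat; apply: ler_sum => k /= ks.
  rewrite gH ?GI// ?ltnS 1?ltnW// -normrN -sinN -mulNr opprB.
  rewrite (mulrC 2) -mulrA ler_pM2l//.
  have Hk := nondecreasing_fun_itv_partition Hle abs ks.
  have := normr_sin_le ((H (G k.+1) - H (G k)) / 2).
  rewrite [X in _ <= X]ger0_norm; last by rewrite divr_ge0// subr_ge0.
  by rewrite ler_pdivlMr// mulrC.
rewrite -mulr_sumr telescope_sumr// /G (itv_partition_nth_size _ abs)/= Ha Hb.
lra.
Qed.

(** The vertices sit at the parameters where [H] takes n + 1 equally spaced values from - pi to pi;
    since [H] is increasing, these parameters form a partition. *)
Lemma polygonal_length_regular (n : nat) : (0 < n)%N ->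
  exists2 s, itv_partition a b s &
    polygonal_length a b g s = n%:R * (2 * r * sin (pi / n%:R)).
Proof.
move=> n0.
have nR : 0 < n%:R :> R by rewrite ltr0n.
have pi0 := pi_gt0 R.
have /choice[T HT] (k : nat) : exists t, (k <= n)%N ->
    t \in `[a, b] /\ H t = - pi + 2 * pi * (k%:R / n%:R).
  have [kn|] := leqP k n; last by exists a.
  have [|t tab Ht] := Hsurj (- pi + 2 * pi * (k%:R / n%:R)).
    have k0 : 0 <= k%:R / n%:R :> R by rewrite divr_ge0.
    have k1 : k%:R / n%:R <= 1 :> R.
      by rewrite ler_pdivrMr// mul1r ler_nat.
    by apply/andP; split; nra.
  by exists t.
have TI k : (k <= n)%N -> T k \in `[a, b] by move=> /HT[].
have HTk k : (k <= n)%N -> H (T k) = - pi + 2 * pi * (k%:R / n%:R) by move=> /HT[].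
have Hinj : {in `[a, b] &, injective H}.
  move=> x y xI yI xy; have [//|] := eqVneq x y.
  rewrite neq_lt => /orP[] /Hlt; rewrite xy ltxx => h; suff: false by []; exact: h.
have aI : a \in `[a, b] by rewrite in_itv/= lexx.
have bI : b \in `[a, b] by rewrite in_itv/= lexx andbT.
have T0 : T 0%N = a.
  by apply: Hinj; rewrite ?TI// HTk// Ha mul0r mulr0 addr0.
have Tn : T n = b.
  by apply: Hinj; rewrite ?TI// HTk// Hb divff ?gt_eqF//; lra.
have Tlt k : (k < n)%N -> T k < T k.+1.
  move=> kn; rewrite ltNge; apply/negP => /(Hle _ _ (TI _ kn) (TI _ (ltnW kn))).
  have [[_ ->] [_ ->]] := (HT _ kn, HT _ (ltnW kn)).
  rewrite lerD2l ler_pM2l; last by lra.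
  by rewrite ler_pM2r ?invr_gt0// ler_nat ltnn.
pose s := [seq T k | k <- iota 1 n].
have sE : a :: s = [seq T k | k <- iota 0 n.+1] by rewrite /= T0.
have ss : size s = n by rewrite size_map size_iota.
have nthE d k : (k <= n)%N -> nth d (a :: s) k = T k.
  by move=> kn; rewrite sE (nth_map 0%N) ?size_iota// nth_iota.
exists s.
  split.
    apply/(pathP b) => k; rewrite ss => kn.
    by rewrite nthE 1?ltnW// -[nth b s k]/(nth b (a :: s) k.+1) nthE// Tlt.
  by rewrite (last_nth a) ss nthE// Tn.
rewrite /polygonal_length ss.
transitivity (\sum_(0 <= k < n) (2 * r * sin (pi / n%:R))).
  apply: eq_big_nat => k /= kn.
  have kn' := ltnW kn.
  (* [s] leaves out the initial point [a], so its entry [k] is vertex k + 1. *)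
  rewrite -[nth b s k]/(nth b (a :: s) k.+1) !nthE//.
  rewrite gH ?TI// (HTk k)// (HTk k.+1)//.
  rewrite -normrN -sinN -mulNr opprB -natr1.
  rewrite (_ : _ / 2 = pi / n%:R); last by field; rewrite gt_eqF.
  rewrite ger0_norm// sin_ge0_pi// divr_ge0 ?(ltW pi0)//=.
  by rewrite ler_pdivrMr// ler_peMr ?(ltW pi0)// ler1n.
by rewrite big_const_nat iter_addr_0 subn0 [RHS]mulr_natl.
Qed.

Lemma curve_length_angle : curve_length a b g = (2 * pi * r)%:E.
Proof.
have pi0 := pi_gt0 R.
apply/eqP; rewrite eq_le; apply/andP; split.
  apply: ge_ereal_sup => _ [s abs <-].
  by rewrite lee_fin polygonal_length_le.
apply/lee_addgt0Pr => e e0.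
(* By [sin_ge_cubic] the n-gon falls short of 2 pi r by at most pi^3 r / n^2, hence by at most pi^3
   r / n, which is below [e] once n > [K]. *)
pose K := pi ^+ 3 * r / e.
have K0 : 0 < K by rewrite divr_gt0// mulr_gt0// exprn_gt0.
pose n := (Num.truncn K).+1.
have n0 : (0 < n)%N by [].
have nR : 0 < n%:R :> R by rewrite ltr0n.
have n1 : 1 <= n%:R :> R by rewrite ler1n.
have Kn : K < n%:R by exact: truncnS_gt.
have [s abs sE] := polygonal_length_regular n n0.
apply: (@le_trans _ _ (polygonal_length a b g s + e)%:E); last first.
  rewrite EFinD leeD2r//; apply: ereal_sup_ubound.
  by exists s.
rewrite lee_fin sE.
have nr0 : 0 <= n%:R * (2 * r) by rewrite mulr_ge0// mulr_ge0// ltW.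
have pin0 : 0 <= pi / n%:R :> R by rewrite divr_ge0// ltW.
have := ler_wpM2l nr0 (sin_ge_cubic _ pin0); rewrite -!mulrA => h.
rewrite -lerBlDr; apply: le_trans h.
rewrite [leRHS](_ : _ = 2 * (pi * r) - pi ^+ 3 * r / n%:R ^+ 2); last first.
  by field; rewrite gt_eqF.
rewrite lerB// ler_pdivrMr ?exprn_gt0//.
move: Kn; rewrite /K ltr_pdivrMr// => /ltW/le_trans; apply.
by rewrite mulrC ler_pM2l// expr2 ler_peMl// ltW.
Qed.

End curve_length_angle.

(** * Area of the unit disc *)

Lemma within_continuous_asin {R : realType} : {within `[-1, 1], continuous (@asin R)}.
Proof.
have pi0 := pi_gt0 R.
rewrite -(@sin_pihalf R) -sinN.
apply: segment_can_le_continuous; [lra| |exact: sinK].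
exact/continuous_subspaceT/continuous_sin.
Qed.

Lemma continuous_sqrt1B {R : realType} :
  continuous (fun x : R => Num.sqrt (1 - x ^+ 2)).
Proof.
move=> x; apply: (@continuous_comp _ _ _ (fun x : R => 1 - x ^+ 2) Num.sqrt).
  by apply: cvgB; [exact: cvg_cst|exact: exprn_continuous].
exact: sqrt_continuous.
Qed.

Lemma is_derive_sqrt_asin {R : realType} (x : R) : -1 < x < 1 ->
  is_derive x 1 (fun x : R => x * Num.sqrt (1 - x ^+ 2) + asin x)
    (2 * Num.sqrt (1 - x ^+ 2)).
Proof.
move=> x11; have /andP[x1 x2] := x11.
have p : 0 < 1 - x ^+ 2.
  by rewrite (_ : _ - _ = (1 - x) * (1 + x)); [apply: mulr_gt0; lra|ring].
have d1 := is_derive1_sqrt p.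
have d2 : is_derive x 1 (fun x : R => 1 - x ^+ 2) (- (2 * x)).
  have -> : (fun x : R => 1 - x ^+ 2) = cst 1 - id ^+ 2.
    by apply/funext => y; rewrite /= !fctE.
  apply: is_derive_eq; rewrite /GRing.scale/= sub0r expr1; lra.
have d3 := @is_derive1_comp R Num.sqrt _ x _ _ d1 d2.
have d4 := @is_derive1_asin R x x11.
have d5 := is_deriveM (is_derive_id x 1) d3.
apply: (@is_derive_eq _ _ _ _ _ _ _ _ (is_deriveD d5 d4)).
rewrite /GRing.scale/=.
have s0 : 0 < Num.sqrt (1 - x ^+ 2) by rewrite sqrtr_gt0.
have := sqr_sqrtr (ltW p).
move: (Num.sqrt _) s0 => s s0 sE.
have sn0 : s != 0 by rewrite gt_eqF.
(* The product rule contributes s - x^2 / s and [asin] contributes 1 / s. *)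
transitivity ((1 - x ^+ 2 + s ^+ 2) / s); first by field.
by rewrite -sE; field.
Qed.

Lemma integral_2sqrt1B {R : realType} :
  (\int[lebesgue_measure]_(x in `[(-1)%R, 1%R]) (2 * Num.sqrt (1 - x ^+ 2) : R)%:E
    = (pi : R)%:E)%E.
Proof.
set F := fun x : R => x * Num.sqrt (1 - x ^+ 2) + asin x.
have asin1 : asin 1 = pi / 2 :> R.
  rewrite -[X in asin X](@sin_pihalf R) sinK// in_itv/= lexx andbT.
  by have := pi_gt0 R; lra.
have asinN1 : asin (-1) = - (pi / 2) :> R.
  rewrite -[X in asin (- X)](@sin_pihalf R) -sinN sinK// in_itv/= lexx/=.
  by have := pi_gt0 R; lra.
rewrite (@continuous_FTC2 R _ F)//.
- rewrite /F asin1 asinN1 sqrrN expr1n subrr sqrtr0 !mulr0 !add0r -EFinB.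
  by congr EFin; lra.
- apply: continuous_subspaceT => x; apply: cvgM; first exact: cvg_cst.
  exact: continuous_sqrt1B.
(* [F] is differentiable only in the open interval; continuity on the closed one supplies the
   one-sided limits at -1 and 1. *)
- have cF : {within `[-1, 1], continuous F}.
    move=> x; apply: cvgD; last exact: within_continuous_asin.
    move: x; apply: continuous_subspaceT => x; apply: cvgM => //.
    exact: continuous_sqrt1B.
  have [|_ ? ?] := (continuous_within_itvP F _).1 cF; first lra.
  split=> // x; rewrite in_itv/= => x1; exact/ex_derive/is_derive_sqrt_asin.
- by move=> x; rewrite in_itv/= => x1; rewrite derive1E; exact/derive_val/is_derive_sqrt_asin.
Qed.

Lemma measure_xsection_disc {R : realType} (x : R) :
  lebesgue_measure (xsection (disc (0 : R * R) 1) x) =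
  ((fun x => (2 * Num.sqrt (1 - x ^+ 2))%:E) \_ `[-1, 1]) x.
Proof.
have x1 : (x \in `[-1, 1]) = (0 <= 1 - x ^+ 2).
  rewrite in_itv/= -ler_norml subr_ge0 -(real_normK (num_real x)).
  by rewrite expr_le1.
rewrite discE// patchE; case: ifPn; rewrite mem_setE x1.
  move=> p; set s := Num.sqrt _.
  rewrite (_ : xsection _ _ = `[- s, s]%classic).
    rewrite lebesgue_measure_itv/= lte_fin.
    have : 0 <= s by exact: sqrtr_ge0.
    case: ifPn => ?; [|move=> ?; congr EFin; lra].
    by move=> _; rewrite -EFinB; congr EFin; lra.
  apply/seteqP; split => y; rewrite xsectionE/= !subr0 expr1n in_itv/= -ler_norml -[`|y|]sqrtr_sqr.
    by rewrite ler_sqrt//; lra.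
  by rewrite ler_sqrt//; lra.
rewrite -ltNge => p; rewrite (_ : xsection _ _ = set0) ?measure0//.
apply/seteqP; split => // y; rewrite xsectionE/= !subr0 expr1n => h.
by have := sqr_ge0 y; lra.
Qed.

Lemma area_piE {R : realType} : area_pi R = pi.
Proof.
(* The product measure unfolds to the integral of the measures of the vertical sections. *)
rewrite /area_pi /area_ratio expr1n divr1 /area /product_measure1.
under eq_integral do rewrite /= measure_xsection_disc.
by rewrite -integral_mkcond integral_2sqrt1B.
Qed.

(** * The angle coordinate on the circle *)

Definition inner {R : realType} (c v p : R * R) : R :=
  v.1 * (p.1 - c.1) + v.2 * (p.2 - c.2).

Definition cross {R : realType} (c v p : R * R) : R :=
  v.1 * (p.2 - c.2) - v.2 * (p.1 - c.1).

(* With [v] of norm r, [inner] and [cross] are r^2 times the cosine and the sine of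
   the angle t such that [p = rotate c v t], and
   tan(t / 2) = sin t / (1 + cos t). *)
Definition angle {R : realType} (c v p : R * R) : R :=
  2 * atan (cross c v p / (v.1 ^+ 2 + v.2 ^+ 2 + inner c v p)).

Lemma circleP {R : realType} (c p : R * R) (r : R) : 0 < r ->
  circle c r p <-> (p.1 - c.1) ^+ 2 + (p.2 - c.2) ^+ 2 = r ^+ 2.
Proof.
move=> r0; rewrite /circle/= /dist2 -(sqrrN (c.1 - _)) -(sqrrN (c.2 - _)) !opprB.
split=> [<-|->]; first by rewrite sqr_sqrtr// addr_ge0// sqr_ge0.
by rewrite sqrtr_sqr gtr0_norm.
Qed.

Lemma angle_itv {R : realType} (c v p : R * R) : - pi < angle c v p < pi.
Proof.
rewrite /angle; set u := _ / _.
by apply/andP; split; [have := atan_gtNpi2 u|have := atan_ltpi2 u]; lra.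
Qed.

Section rotate_angle.
Context {R : realType} {c v : R * R} {r : R}.
Hypotheses (r0 : 0 < r) (vr : v.1 ^+ 2 + v.2 ^+ 2 = r ^+ 2).

Let r20 : 0 < r ^+ 2. Proof. by rewrite exprn_gt0. Qed.

Lemma rotatepi : rotate c v pi = (c.1 - v.1, c.2 - v.2).
Proof. by rewrite /rotate cospi sinpi !mulr0 subr0 addr0 !mulrN1. Qed.

Lemma rotateNpi : rotate c v (- pi) = (c.1 - v.1, c.2 - v.2).
Proof. by rewrite -rotatepi /rotate cosN sinN sinpi oppr0. Qed.

Lemma circle_rotate t : circle c r (rotate c v t).
Proof.
apply/circleP => //=.
rewrite -vr -[RHS]mulr1 -(cos2Dsin2 t); ring.
Qed.

(** Twice this quantity is the squared distance from [p] to the point opposite to c + v. It is the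
    denominator in [angle]. *)
Lemma inner_gt0 p : circle c r p -> p <> (c.1 - v.1, c.2 - v.2) ->
  0 < r ^+ 2 + inner c v p.
Proof.
move=> /circleP -/(_ r0) pr pv.
have E : (p.1 - c.1 + v.1) ^+ 2 + (p.2 - c.2 + v.2) ^+ 2 =
    2 * (r ^+ 2 + inner c v p).
  rewrite mulrDr mulr_natl mulr2n -{1}pr -vr /inner; ring.
rewrite -(@pmulr_rgt0 _ 2)// -E lt0r paddr_eq0 ?sqr_ge0// addr_ge0 ?sqr_ge0// andbT.
rewrite !sqrf_eq0; apply/negP => /andP[/eqP h1 /eqP h2]; apply: pv.
by rewrite [p]surjective_pairing; congr pair; lra.
Qed.

(** Here [u] is the tangent of the half angle, so cosine and sine of the angle are rational in [u];
    they come out as [X] and [Y] over r^2. *)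
Lemma angleK p : circle c r p -> p <> (c.1 - v.1, c.2 - v.2) ->
  rotate c v (angle c v p) = p.
Proof.
move=> pC pv; have d0 := inner_gt0 p pC pv.
have /circleP -/(_ r0) pr := pC.
rewrite /angle vr.
(* Lagrange's identity for the vectors v and p - c. *)
have XY : inner c v p ^+ 2 + cross c v p ^+ 2 = r ^+ 2 * r ^+ 2.
  by rewrite -{1}vr -pr /inner /cross; ring.
set X := inner c v p; set Y := cross c v p; set u := Y / _.
have u1 : (1 + u ^+ 2)^-1 = (r ^+ 2 + X) / (2 * r ^+ 2).
  rewrite -[RHS]invrK; congr (_^-1).
  have -> : 1 + u ^+ 2 = (r ^+ 2 * r ^+ 2 + 2 * r ^+ 2 * X +
      (X ^+ 2 + Y ^+ 2)) / (r ^+ 2 + X) ^+ 2.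
    by rewrite /u; field; rewrite gt_eqF.
  by rewrite XY; field; rewrite !gt_eqF.
have c2 : cos (atan u) ^+ 2 = (r ^+ 2 + X) / (2 * r ^+ 2).
  by rewrite cos_atan exprVn sqr_sqrtr// addr_ge0// sqr_ge0.
have cE : cos (2 * atan u) = X / r ^+ 2.
  by rewrite mulr_natl cos_mulr2n c2; field; rewrite gt_eqF.
have sE : sin (2 * atan u) = Y / r ^+ 2.
  have ca : cos (atan u) != 0.
    by rewrite gt_eqF// cos_gt0_pihalf// atan_gtNpi2 atan_ltpi2.
  have sa : sin (atan u) = u * cos (atan u).
    by rewrite -{2}[u]atanK /tan divfK.
  rewrite mulr_natl sin_mulr2n sa mulrCA -expr2 c2 /u; field.
  by rewrite !gt_eqF.
rewrite /rotate cE sE [RHS]surjective_pairing; congr pair.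
  transitivity (c.1 + (v.1 ^+ 2 + v.2 ^+ 2) * (p.1 - c.1) / r ^+ 2).
    by rewrite /X /Y /inner /cross; ring.
  by rewrite vr; field; rewrite gt_eqF.
transitivity (c.2 + (v.1 ^+ 2 + v.2 ^+ 2) * (p.2 - c.2) / r ^+ 2).
  by rewrite /X /Y /inner /cross; ring.
by rewrite vr; field; rewrite gt_eqF.
Qed.

Lemma rotateK t : - pi < t < pi -> angle c v (rotate c v t) = t.
Proof.
move=> /andP[t1 t2].
have ch : 0 < cos (t / 2) by apply: cos_gt0_pihalf; apply/andP; split; lra.
have XE : inner c v (rotate c v t) = r ^+ 2 * cos t.
  by rewrite -vr /inner /=; ring.
have YE : cross c v (rotate c v t) = r ^+ 2 * sin t.
  by rewrite -vr /cross /=; ring.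
rewrite /angle XE YE vr.
have tE : t = (t / 2) *+ 2 by rewrite -mulr_natr divfK.
rewrite (_ : _ / _ = tan (t / 2)).
  rewrite tanK; last by rewrite in_itv/=; apply/andP; split; lra.
  by rewrite mulrC divfK.
rewrite [in LHS]tE cos_mulr2n sin_mulr2n /tan.
rewrite (_ : _ + _ = 2 * r ^+ 2 * cos (t / 2) ^+ 2); last by ring.
by field; rewrite !gt_eqF.
Qed.

End rotate_angle.

(** * Length of an arbitrary simple parametrization of the circle *)

Lemma circle_curve_length {R : realType} (c : R * R) (r : R) (a b : R) (g : R -> R * R) :
  0 < r -> simple_closed_parametrization (circle c r) a b g ->
  curve_length a b g = (2 * pi * r)%:E.
Proof.
move=> r0 [ab gc gab ginj gim].
have pi0 := pi_gt0 R.
(* This choice puts the cut of [angle] at c - v = g a, the point where the parametrization starts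
   and ends. *)
pose v := (c.1 - (g a).1, c.2 - (g a).2).
have gC t : t \in `[a, b] -> circle c r (g t) by rewrite -gim => tI; exists t.
have aI : a \in `[a, b] by rewrite in_itv/= lexx ltW.
have bI : b \in `[a, b] by rewrite in_itv/= lexx ltW.
have vr : v.1 ^+ 2 + v.2 ^+ 2 = r ^+ 2.
  have /circleP -/(_ r0) <- := gC a aI.
  by rewrite /v/=; ring.
have ga : g a = (c.1 - v.1, c.2 - v.2).
  by rewrite /v/= !subKr -surjective_pairing.
have gnv t : t \in `]a, b[ -> g t <> (c.1 - v.1, c.2 - v.2).
  rewrite in_itv/= -ga => /andP[at_ tb] /ginj.
  rewrite !in_itv/= lexx ab (ltW at_) tb => /(_ isT isT) ta.
  by move: at_; rewrite ta ltxx.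
have oc t : t \in `]a, b[ -> t \in `[a, b] by exact: subset_itv_oo_cc.
have gE t : t \in `]a, b[ -> rotate c v (angle c v (g t)) = g t.
  by move=> tI; rewrite (angleK r0 vr)//; [exact/gC/oc|exact: gnv].
have cont : {within [set` `]a, b[], continuous (angle c v \o g)}.
  apply: continuous_in_subspaceT => t; rewrite inE/= => tI.
  have [gI _ _] := (continuous_within_itvP g ab).1 gc.
  have g1 : (g s).1 @[s --> t] --> (g t).1.
    by apply: (continuous_comp (gI t tI)); exact: cvg_fst.
  have g2 : (g s).2 @[s --> t] --> (g t).2.
    by apply: (continuous_comp (gI t tI)); exact: cvg_snd.
  apply: cvgM; first exact: cvg_cst.
  apply: (@continuous_comp _ _ _ (fun s => cross c v (g s) /
    (v.1 ^+ 2 + v.2 ^+ 2 + inner c v (g s))) atan); last exact: continuous_atan.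
  have k (w : R) f x : f s @[s --> t] --> (x : R) -> w * f s @[s --> t] --> w * x.
    by move=> fx; apply: cvgM => //; exact: cvg_cst.
  have l (w : R) f x : f s @[s --> t] --> (x : R) -> f s - w @[s --> t] --> x - w.
    by move=> fx; apply: cvgB => //; exact: cvg_cst.
  apply: cvgM; first by apply: cvgB; apply/k/l.
  apply: cvgV; last first.
    by apply: cvgD; [exact: cvg_cst|apply: cvgD; apply/k/l].
  by rewrite vr gt_eqF// (inner_gt0 r0 vr)//; [exact/gC/oc|exact: gnv].
have inj : {in `]a, b[ &, injective (angle c v \o g)}.
  move=> s t sI tI /= st; apply: ginj; [| |by rewrite -(gE s)// -(gE t)// st].
    by move: sI; rewrite !in_itv/= => /andP[/ltW-> ->].
  by move: tI; rewrite !in_itv/= => /andP[/ltW-> ->].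
(* The sign [e] is the direction in which [g] runs around the circle. *)
have [e e1 He] : exists2 e : R, e = 1 \/ e = -1 &
    {in `]a, b[ &, {homo (fun t => e * angle c v (g t)) : s t / s < t}}.
  have [h|h] := itv_continuous_inj_mono cont inj.
    by exists 1; [left|move=> s t sI tI st; rewrite !mul1r; exact: h].
  by exists (-1); [right|move=> s t sI tI st; rewrite !mulN1r ltrN2; exact: h].
have ee x : e * (e * x) = x by case: e1 => ->; ring.
have epi x : - pi < x < pi -> - pi < e * x < pi.
  by case: e1 => -> /andP[? ?]; apply/andP; split; lra.
(* At both ends [angle] takes the default value 0, coming from a zero denominator, so the limit
   angles are prescribed by hand; the factor [e] makes [H] increasing. *)
pose H t := if t == a then - pi else if t == b then pi else e * angle c v (g t).
have Ha : H a = - pi by rewrite /H eqxx.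
have Hb : H b = pi by rewrite /H eqxx gt_eqF.
have Ho t : t \in `]a, b[ -> H t = e * angle c v (g t).
  by rewrite in_itv/= => /andP[? ?]; rewrite /H gt_eqF// lt_eqF.
have Hpi t : t \in `]a, b[ -> - pi < H t < pi.
  by move=> /Ho ->; exact/epi/angle_itv.
have cases t : t \in `[a, b] -> [\/ t = a, t = b | t \in `]a, b[].
  rewrite in_itv/= !le_eqVlt => /andP[/predU1P[<-|h1] /predU1P[h2|h2]].
  - by constructor 1.
  - by constructor 1.
  - by constructor 2.
  - by constructor 3; rewrite in_itv/= h1.
have gH t : t \in `[a, b] -> g t = rotate c v (e * H t).
  have rpi x : x = pi \/ x = - pi -> rotate c v (e * x) = g a.
    by case: e1 => -> [] ->; rewrite ?mul1r ?mulN1r ?opprK ?rotatepi ?rotateNpi.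
  move=> /cases[->|->|tI].
  - by rewrite Ha rpi//; right.
  - by rewrite Hb rpi//; left.
  - by rewrite Ho// ee gE.
apply: (@curve_length_angle _ a b r g H) => //.
- exact: ltW.
- move=> s t /cases sI /cases tI st.
  case: sI => [sa|sb|sI].
  + rewrite sa Ha; case: tI => [ta|->|/Hpi/andP[]//]; last by rewrite Hb; lra.
    by move: st; rewrite sa ta ltxx.
  + move: st; rewrite sb; case: tI => [->|->|]; rewrite ?ltxx//.
      by move=> /(lt_trans ab); rewrite ltxx.
    by rewrite in_itv/= => /andP[_ tb] /(lt_trans tb); rewrite ltxx.
  + case: tI => [ta|->|tI]; last by rewrite !Ho//; exact: He.
      by move: sI st; rewrite in_itv/= ta => /andP[as_ _] /(lt_trans as_); rewrite ltxx.
    by rewrite Hb; case/andP: (Hpi s sI).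
(* Surjectivity comes from [g] covering the circle: the point at angle e * t is some g s, and
   [rotateK] recovers the angle. *)
- move=> t; rewrite !le_eqVlt => /andP[/predU1P[<-|t1]]; first by exists a.
  move=> /predU1P[->|t2]; first by exists b.
  have tpi : - pi < e * t < pi by apply: epi; rewrite t1.
  have [s sI gs] : (g @` `[a, b]) (rotate c v (e * t)).
    by rewrite gim; exact: circle_rotate.
  exists s => //.
  (* The chord from g a, at angle pi, to the point at angle e * t has positive length, as half the
     angle difference lies strictly between 0 and pi. *)
  have gsa : g s <> g a.
    move=> gsa; have := dist2_rotate c v r pi (e * t) (ltW r0) vr.
    rewrite rotatepi -gs gsa ga /dist2 !subrr expr0n/= addr0 sqrtr0.
    apply/eqP; rewrite lt_eqF// !mulr_gt0// normr_gt0 gt_eqF//.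
    by case/andP: tpi => ? ?; apply: sin_gt0_pi; apply/andP; split; lra.
  have [sa|sb|so] := cases _ sI; [by rewrite sa in gsa|by rewrite sb gab in gsa|].
  by rewrite Ho// gs (rotateK r0 vr)// ee.
(* The sign [e] drops out because the absolute value of the sine is even. *)
- move=> s t sI tI; rewrite gH// (gH t)// (dist2_rotate _ _ r)//; last exact: ltW.
  rewrite -mulrBr -[e * _ / 2]mulrA; case: e1 => ->; rewrite ?mul1r//.
  by rewrite mulN1r sinN normrN.
Qed.

Theorem corollary7 (R : realType) (c : R * R) (r : R) (hr : 0 < r)
    (C : \bar R) (hC : is_circumference c r C) :
  C = (2 * area_pi R * r)%:E.
Proof.
have [a [b [g [gP <-]]]] := hC.
by rewrite area_piE (circle_curve_length c r).
Qed.
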